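(* Let $q$ be a prime power, let $b(T)\in\mathbb F_q[T]$ have degree $m\ge 1$, let $\ell\ge1$, and let $\langle \mathrm{Trun}^L_{q,b}\rangle_{b^\ell}:=\frac{1}{q^{m\ell}}\sum_{f\in\mathbb F_q[T],\ \deg f<m\ell}\mathrm{Trun}^L_{q,b}(f)$. Then \[\langle \mathrm{Trun}^L_{q,b}\rangle_{b^\ell} = \sum_{\substack{1 \le h < m \ell \\ h \equiv -1 \pmod m}} \frac 1h + O\left(\frac{\log \ell}{mq} + \frac 1q \right) \text{ as } q \to \infty,\] \[\langle \mathrm{Trun}^L_{q,b}\rangle_{b^\ell} = \frac 1m \sum_{h=1}^\ell \frac 1h + \frac{q}{(q-1)m^2} \sum_{h=1}^\ell \frac 1{h^2} + O\left(\frac 1{m^3} + \frac{q \log^2(m\ell)}{q^{m/2}}\right) \text{ as } m \to \infty,\] and \[\langle \mathrm{Trun}^L_{q,b}\rangle_{b^\ell} = \frac{1}m \left(1-\frac{1}{q^m}\right)\log \ell + O\left(\frac 1m + \frac 1q \right) \text{ as } \ell \to \infty.\]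
   Context: For $f\in\mathbb F_q[T]$, $\mathrm{Trun}^L_{q,b}(f)$ is the number of irreducible (not necessarily monic) polynomials $g\in\mathbb F_q[T]$ with $\deg g\le \deg f$ and $g\equiv f \pmod{b^{\lfloor \deg(g)/m\rfloor+1}}$; equivalently, writing $f=\sum_j a_j(T)b(T)^j$ with $\deg a_j<m$, these $g$ are the irreducible polynomials among the truncations $\sum_{j=0}^i a_j b^j$ with $a_i\ne0$. Implied constants in error terms are independent of $q$, $m$, $\ell$ (and $b$). *)

(* Defs.v *)
From HB Require Import structures.
From mathcomp Require Import all_boot all_order all_algebra.
From mathcomp Require Import all_classical all_reals all_analysis.

Set Implicit Arguments.
Unset Strict Implicit.
Unset Printing Implicit Defensive.
Import Order.TTheory GRing.Theory Num.Theory.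
Local Open Scope ring_scope.

(* {poly_n F} is the finite type of polynomials p with size p <= n, that is
   deg p < n.  Hence g : {poly_(size f) F} encodes deg g <= deg f (no nonzero g
   when f = 0), and the degree of a nonzero g is (size g).-1. *)
Definition truncL (F : finFieldType) (b f : {poly F}) : nat :=
  #|[set g : {poly_(size f) F} |
      `[< irreducible_poly g >] &&
      (b ^+ ((size g).-1 %/ (size b).-1).+1 %| (g : {poly F}) - f)]|.

Definition mean_truncL (R : realType) (F : finFieldType) (b : {poly F})
    (l : nat) : R :=
  (#|F|%:R ^+ ((size b).-1 * l))^-1 *
  \sum_(f : {poly_((size b).-1 * l) F}) (truncL b f)%:R.

(* Main.v *)
(** An irreducible [g] of degree [h] is a truncation of exactly [q^(m l - m k)]
    polynomials [f] of degree [< m l], where [k = h / m + 1].  Writing [pi] for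
    the number of monic irreducibles, the mean is therefore the sum over
    [1 <= k <= l] and [1 <= r <= m] of [(1 - x) x^(r - 1) * pi(h) / q^h], where
    [x = 1 / q] and [h = m k - r].

    Since ['X^(q^n) - 'X] is the product of the monic irreducible polynomials of
    degree dividing [n], [pi(h) / q^h] is [1 / h] up to an error [O(q^(-h/2))]
    which vanishes for [h = 1].  Replacing [pi(h) / q^h] by [1 / h] costs at most
    [O(1/q)], and also at most [O(q^((1-m)/2))].

    The remaining sum averages [1 / (m k - r)] over a geometric distribution in
    [r], whose moments are bounded uniformly in [q].  Expanding [1 / (m k - r)]
    in powers of [r / (m k)] to order 2 and 1 gives the second and the third
    estimate; for the first one the weights themselves are compared with the
    point mass at [r = 1]. *)

Require Import Defs.
From HB Require Import structures.
From mathcomp Require Import all_boot all_order all_algebra all_field.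
From mathcomp Require Import all_classical all_reals all_analysis.
From mathcomp Require Import zify ring lra.
Set Implicit Arguments.
Unset Strict Implicit.
Unset Printing Implicit Defensive.
Import Order.TTheory GRing.Theory Num.Theory.
Local Open Scope ring_scope.

(** * Irreducible polynomials over a field *)

Section IrreduciblePolynomials.
Variable F : fieldType.
Implicit Types (p g h u : {poly F}) (s : seq {poly F}).

Lemma irreducible_polyZ (c : F) p : c != 0 ->
  irreducible_poly (c *: p) <-> irreducible_poly p.
Proof.
have scaled d u : d != 0 -> irreducible_poly u -> irreducible_poly (d *: u).
  move=> d0 [u1 uI]; split=> [|v v1]; first by rewrite size_scale.
  by rewrite dvdpZr // => /(uI v v1) vu; rewrite (eqp_trans vu) // eqp_sym eqp_scale.
move=> c0; split=> [cpI|]; last exact: scaled.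
by rewrite -[p](scalerK c0); apply: scaled; rewrite ?invr_eq0.
Qed.

Lemma monic_irreducible_scale p : irreducible_poly p ->
  monic_irreducible_poly ((lead_coef p)^-1 *: p).
Proof.
move=> pI; have lp0 : lead_coef p != 0 by rewrite lead_coef_eq0 irredp_neq0.
split; first by apply/irreducible_polyZ; rewrite ?invr_eq0.
by rewrite monicE lead_coefZ mulVf.
Qed.

Lemma irreducible_factor p : (1 < size p)%N ->
  exists2 g, irreducible_poly g & g %| p.
Proof.
have [n] := ubnP (size p); elim: n => // n IHn in p * => sp p1.
have p0 : p != 0 by rewrite -size_poly_gt0 ltnW.
have [pI|pNI] := pselect (irreducible_poly p); first by exists p.
have [u [u1 up uNp]] : exists u, [/\ size u != 1, u %| p & ~~ (u %= p)].
  apply: contrapT => noFactor; apply: pNI; split=> // u u1 up.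
  by apply: contrapT => /negP uNp; apply: noFactor; exists u.
have u0 : u != 0 by apply: contraTneq up => ->; rewrite dvd0p.
have u_lt : (size u < size p)%N by rewrite ltn_neqAle dvdp_leq // dvdp_size_eqp ?uNp.
have [||g gI gu] := IHn u; first exact: leq_trans u_lt _.
  by rewrite ltn_neqAle eq_sym u1 size_poly_gt0.
by exists g => //; exact: dvdp_trans gu up.
Qed.

Lemma monic_irreducible_factor p : (1 < size p)%N ->
  exists2 g, monic_irreducible_poly g & g %| p.
Proof.
move=> /irreducible_factor[g gI gp]; exists ((lead_coef g)^-1 *: g).
  exact: monic_irreducible_scale.
by rewrite dvdpZl // invr_eq0 lead_coef_eq0 irredp_neq0.
Qed.

Lemma coprimep_monic_irreducible g h : monic_irreducible_poly g ->
  monic_irreducible_poly h -> g != h -> coprimep g h.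
Proof.
move=> [gI gM] [hI hM]; rewrite (irreducible_poly_coprime h gI); apply: contra => gh.
by rewrite -eqp_monic // hI // gtn_eqF // gI.1.
Qed.

Lemma in_qpoly_eq0 g u : monic_irreducible_poly g ->
  (in_qpoly g u == 0) = (g %| u).
Proof.
move=> gI; rewrite -val_eqE /= -Pdiv.IdomainMonic.modpE ?monic_mk_monic //.
by rewrite mk_monicE.
Qed.

Lemma prod_monic_irreducible_dvdp s u : uniq s ->
  {in s, forall g, monic_irreducible_poly g} -> {in s, forall g, g %| u} ->
  \prod_(g <- s) g %| u.
Proof.
elim: s => [|g s IHs] /=; first by rewrite big_nil dvd1p.
move=> /andP[gs us] /forall_cons[gI sI] /forall_cons[gu su].
rewrite big_cons Gauss_dvdp ?gu ?IHs // big_seq.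
apply: (big_ind (coprimep g)) => [|v w gv gw|h hs].
- exact: coprimep1.
- by rewrite coprimepMr gv.
- by apply: coprimep_monic_irreducible (sI h hs) _ => //; apply: contraNneq gs => ->.
Qed.

Lemma separable_dvdp p u : separable_poly p ->
  (forall g, monic_irreducible_poly g -> g %| p -> g %| u) -> p %| u.
Proof.
have [n] := ubnP (size p); elim: n => // n IHn in p * => sp sep_p factor_dvd.
have p0 := separable_poly_neq0 sep_p.
have [p1|p1] := leqP (size p) 1.
  by rewrite (@eqp_dvdl _ 1) ?dvd1p // -size_poly_eq1 eqn_leq p1 size_poly_gt0.
have [g gI /dvdpP[v pE]] := monic_irreducible_factor p1.
move: sep_p factor_dvd sp; rewrite {}pE separable_mul => /and3P[sep_v _ vg] factor_dvd.
have v0 := separable_poly_neq0 sep_v; have g0 := irredp_neq0 gI.1.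
rewrite size_mul // => sp; rewrite Gauss_dvdp //.
rewrite [g %| u]factor_dvd ?dvdp_mull // andbT; apply: IHn => // [|h hI hv].
  by have := gI.1.1; move: sp; move: (size v) (size g) => a c; lia.
by apply: factor_dvd => //; rewrite dvdp_mulr.
Qed.

Lemma degree_prod s : {in s, forall g, g != 0} ->
  (size (\prod_(g <- s) g)).-1 = (\sum_(g <- s) (size g).-1)%N.
Proof.
move=> s0; rewrite size_prod_seq //.
have -> : (\sum_(g <- s) size g = \sum_(g <- s) (size g).-1 + size s)%N.
  rewrite -sum1_size -big_split /=; apply: eq_big_seq => g /s0.
  by rewrite -size_poly_gt0 addn1 => /prednK.
by rewrite -addSn addnK.
Qed.
End IrreduciblePolynomials.

(** * Counting irreducible polynomials over a finite field *)

Lemma size_XnsubX (R : nzRingType) n : (1 < n)%N ->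
  size ('X^n - 'X : {poly R}) = n.+1.
Proof. by move=> n1; rewrite size_polyDl size_polyXn // size_polyN size_polyX. Qed.

Lemma monic_XnsubX (R : nzRingType) n : (1 < n)%N -> 'X^n - 'X \is @monic R.
Proof.
move=> n1; rewrite monicE lead_coefDl ?lead_coefXn //.
by rewrite size_polyXn size_polyN size_polyX.
Qed.

Lemma sum_expn_le a n : (1 < a)%N -> (\sum_(1 <= d < n.+1) a ^ d <= 2 * a ^ n)%N.
Proof.
move=> a1; elim: n => [|n IHn]; first by rewrite big_geq.
rewrite big_nat_recr //= (leq_trans (leq_add IHn (leqnn _))) //.
by rewrite expnS [leqRHS]mul2n -addnn leq_add2r leq_mul2r a1 orbT.
Qed.

Section FiniteFields.
Variable F : finFieldType.
Implicit Types (d k n : nat) (p g u : {poly F}).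
Local Notation q := #|F|.

Lemma card_exp_gt1 n : (0 < n)%N -> (1 < q ^ n)%N.
Proof. by move=> n0; rewrite -(exp1n n) ltn_exp2r // finNzRing_gt1. Qed.

Lemma expf_card_exp n (y : F) : y ^+ (q ^ n) = y.
Proof. by elim: n => [|n IHn]; rewrite ?expr1 // expnSr exprM IHn expf_card. Qed.

Lemma leq_card_expr_fixed n : (1 < n)%N -> (forall y : F, y ^+ n = y) -> (q <= n)%N.
Proof.
move=> n1 fixed; have sP := size_XnsubX F n1.
rewrite -ltnS -sP cardE; apply: max_poly_roots; rewrite ?enum_uniq //.
  by rewrite -size_poly_eq0 sP.
by apply/allP => y _; rewrite rootE !hornerE fixed subrr.
Qed.

Lemma exprn_card_comp p n : p ^+ (q ^ n) = p \Po 'X^(q ^ n).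
Proof.
have q_pnat : [pchar {poly F}].-nat (q ^ n)%N.
  have [r r_pr rF] := finPcharP F.
  rewrite (card_pprimeChar rF) !pnatX pnatE //.
  by rewrite (_ : r \in [pchar {poly F}]) // pchar_poly.
elim/poly_ind: p => [|p c IHp].
  by rewrite comp_poly0 expr0n expn_eq0 eqn0Ngt (ltnW (finNzRing_gt1 F)).
by rewrite (exprDn_pchar _ _ q_pnat) exprMn IHp comp_polyD comp_polyM
  comp_polyX comp_polyC -polyC_exp expf_card_exp.
Qed.

Lemma separable_XqnsubX n : (0 < n)%N ->
  separable_poly ('X^(q ^ n) - 'X : {poly F}).
Proof.
move=> n0; have qF0 : (q ^ n)%:R = 0 :> F.
  have [r r_pr rF] := finPcharP F; have := card_exp_gt1 n0.
  rewrite (card_pprimeChar rF) -expnM; case: (_ * n)%N => [|e] // _.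
  by apply/eqP; rewrite -(dvdn_pcharf rF) dvdn_exp.
rewrite unlock derivB derivXn derivX -mulr_natr -polyC_natr qF0 mulr0 sub0r.
by rewrite -[- 1]scaleN1r coprimepZr ?coprimep1 // oppr_eq0 oner_eq0.
Qed.
End FiniteFields.

Section PolynomialsOfBoundedSize.
Variable R : finNzSemiRingType.
Implicit Types (n : nat) (p : {poly R}).

Definition polys_of_size n : seq {poly R} := [seq polyn f | f <- enum {poly_n R}].

Lemma mem_polys_of_size n p : (p \in polys_of_size n) = (size p <= n)%N.
Proof.
apply/mapP/idP => [[f _ ->]|sp]; first exact: size_npoly.
by exists (NPoly (sp : p \is a poly_of_size n)); rewrite ?mem_enum.
Qed.

Lemma uniq_polys_of_size n : uniq (polys_of_size n).
Proof. by rewrite map_inj_uniq ?enum_uniq //; exact: val_inj. Qed.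

Lemma size_polys_of_size n : size (polys_of_size n) = (#|R| ^ n)%N.
Proof. by rewrite size_map -cardE card_npoly. Qed.

Lemma card_npoly_set n (P : pred {poly R}) :
  #|[set f : {poly_n R} | P f]| = size [seq p <- polys_of_size n | P p].
Proof. by rewrite cardsE size_filter count_map -size_filter cardE enumT. Qed.
End PolynomialsOfBoundedSize.

Section MonicIrreducibles.
Variable F : finFieldType.
Implicit Types (d k n : nat) (p g u : {poly F}).
Local Notation q := #|F|.

Lemma monic_irreducible_dvdp_XqnsubX g n : monic_irreducible_poly g ->
  ((size g).-1 %| n)%N -> g %| 'X^(q ^ n) - 'X.
Proof.
move=> gI /dvdnP[k ->]; rewrite -(in_qpoly_eq0 _ gI) rmorphB rmorphXn subr_eq0 /=.
rewrite mulnC expnM -(card_qfpoly gI); apply/eqP.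
exact: (@expf_card_exp {poly %/ g with gI} k (in_qpoly g 'X)).
Qed.

Lemma qfpoly_expr_fixed g n (gI : monic_irreducible_poly g) :
  g %| 'X^(q ^ n) - 'X -> forall y : {poly %/ g with gI}, y ^+ (q ^ n) = y.
Proof.
move=> gn y; have -> : y = in_qpoly g (val y) :> {poly %/ g}.
  by apply/val_inj; rewrite [RHS]in_qpoly_small // size_mk_monic.
have X_fixed : in_qpoly g 'X^(q ^ n) = in_qpoly g 'X.
  by apply/eqP; rewrite -subr_eq0 -rmorphB in_qpoly_eq0.
rewrite -[LHS](rmorphXn (in_qpoly g)) /= exprn_card_comp in_qpoly_comp_horner X_fixed.
by rewrite -in_qpoly_comp_horner comp_polyXr.
Qed.

(* The field [F[X] / (g)] has [q ^ deg g] elements, all fixed by [y |-> y ^ (q ^ r)]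
   for the remainder [r] of [n] modulo [deg g]; a nonzero [r] would be too small. *)
Lemma dvdp_XqnsubX g n : monic_irreducible_poly g ->
  (g %| 'X^(q ^ n) - 'X) = ((size g).-1 %| n)%N.
Proof.
move=> gI; apply/idP/idP => [gn|]; last exact: monic_irreducible_dvdp_XqnsubX.
pose K : finFieldType := {poly %/ g with gI}; set d := (size g).-1.
have cK : #|K| = (q ^ d)%N := card_qfpoly gI.
have d_gt0 : (0 < d)%N by have := gI.1.1; rewrite /d; case: size => [|[]].
have fixed (y : K) : y ^+ (q ^ (n %% d)) = y.
  rewrite -[RHS](qfpoly_expr_fixed gn) {2}(divn_eq n d) expnD exprM mulnC expnM -cK.
  by rewrite expf_card_exp.
rewrite /dvdn; apply: contraTT (ltn_pmod n d_gt0) => r_neq0; rewrite -leqNgt.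
rewrite -(leq_exp2l _ _ (finNzRing_gt1 F)) -cK.
by apply: leq_card_expr_fixed fixed; rewrite card_exp_gt1 // lt0n.
Qed.

Definition monic_irr d : seq {poly F} := [seq p <- polys_of_size F d.+1 |
  [&& `[< irreducible_poly p >], p \is monic & size p == d.+1]].

Lemma monic_irrP d p :
  reflect (monic_irreducible_poly p /\ size p = d.+1) (p \in monic_irr d).
Proof.
rewrite mem_filter mem_polys_of_size; apply: (iffP andP).
  by move=> [/and3P[/asboolP pI pM /eqP sp] _].
move=> [[pI pM] sp]; rewrite sp pM eqxx leqnn; split=> //.
by apply/and3P; split=> //; apply/asboolP.
Qed.

Lemma uniq_monic_irr d : uniq (monic_irr d).
Proof. exact/filter_uniq/uniq_polys_of_size. Qed.

Lemma uniq_flatten_monic_irr (ds : seq nat) : uniq ds ->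
  uniq (flatten [seq monic_irr d | d <- ds]).
Proof.
have eq_degree d e g : g \in monic_irr d -> g \in monic_irr e -> d = e.
  by move=> /monic_irrP[_ sd] /monic_irrP[_]; rewrite sd => -[].
elim: ds => //= d ds IHds /andP[dds uds]; rewrite cat_uniq uniq_monic_irr IHds // andbT.
apply/hasPn => g /flatten_mapP[e eds ge].
by apply: contra dds => /(eq_degree _ e g) ->.
Qed.

Definition nb_monic_irr d := size (monic_irr d).

Lemma nb_monic_irr0 : nb_monic_irr 0 = 0%N.
Proof.
apply/eqP; rewrite eqn0Ngt -has_predT; apply/hasP => -[p].
by move=> /monic_irrP[[[p1 _] _] sp] _; rewrite sp in p1.
Qed.

Lemma XqnsubX_prod n : (0 < n)%N ->
  'X^(q ^ n) - 'X = \prod_(g <- flatten [seq monic_irr d | d <- divisors n]) g.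
Proof.
move=> n0; set s := flatten _.
have sP g : reflect (monic_irreducible_poly g /\ g %| 'X^(q ^ n) - 'X) (g \in s).
  apply: (iffP flatten_mapP) => [[d dn /monic_irrP[gI sg]]|[gI gn]].
    by split=> //; rewrite dvdp_XqnsubX // sg dvdn_divisors.
  exists (size g).-1; first by rewrite -dvdn_divisors // -dvdp_XqnsubX.
  by apply/monic_irrP; split=> //; have := gI.1.1; case: size.
have s_monic : \prod_(g <- s) g \is monic.
  by rewrite big_seq; apply: monic_prod => g /sP[[]].
apply/eqP; rewrite -eqp_monic ?monic_XnsubX ?card_exp_gt1 //; apply/andP; split.
  apply: separable_dvdp => [|g gI gn]; first exact: separable_XqnsubX.
  have gs : g \in s by apply/sP.
  by rewrite (big_rem _ gs) dvdp_mulr.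
apply: prod_monic_irreducible_dvdp => [|g /sP[]|g /sP[]] //.
exact/uniq_flatten_monic_irr/divisors_uniq.
Qed.

Lemma sum_divisors_nb_monic_irr n : (0 < n)%N ->
  (\sum_(d <- divisors n) d * nb_monic_irr d = q ^ n)%N.
Proof.
move=> n0; have /(congr1 (fun p : {poly F} => (size p).-1)) := XqnsubX_prod n0.
rewrite size_XnsubX ?card_exp_gt1 //= => ->; rewrite degree_prod; last first.
  by move=> g /flatten_mapP[d _ /monic_irrP[[_ gM] _]]; exact: monic_neq0.
rewrite big_flatten big_map; apply: eq_bigr => d _.
rewrite (eq_big_seq (fun=> d)) => [|g /monic_irrP[_ ->]] //.
by rewrite big_const_seq count_predT iter_addn_0.
Qed.

Lemma nb_monic_irr1 : nb_monic_irr 1 = q.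
Proof. by have := sum_divisors_nb_monic_irr (ltn0Sn 0); rewrite big_seq1 mul1n expn1. Qed.

Lemma nb_monic_irr_le n : (n * nb_monic_irr n <= q ^ n)%N.
Proof.
case: (posnP n) => [-> //|n0]; rewrite -sum_divisors_nb_monic_irr //.
by rewrite (bigD1_seq n) ?divisors_id ?divisors_uniq //= leq_addr.
Qed.

(* The proper divisors of [n] are at most [n / 2]. *)
Lemma nb_monic_irr_ge n : (0 < n)%N ->
  (q ^ n <= n * nb_monic_irr n + 2 * q ^ n./2)%N.
Proof.
move=> n0; rewrite -(sum_divisors_nb_monic_irr n0).
rewrite (bigD1_seq n) ?divisors_id ?divisors_uniq //= leq_add2l.
apply: leq_trans (sum_expn_le _ (finNzRing_gt1 F)).
have proper_divisor d : d \in [seq d <- divisors n | d != n] -> d \in index_iota 1 n./2.+1.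
  rewrite mem_filter mem_index_iota -dvdn_divisors // => /andP[dn] /dvdnP[k nE].
  rewrite ltnS geq_half_double -muln2; case: k nE n0 dn => [|[|k]] -> //.
    by rewrite mul1n eqxx.
  by rewrite muln_gt0 /= => -> _; rewrite mulnC leq_mul2r orbT.
rewrite -big_filter.
apply: (@leq_trans (\sum_(d <- [seq d <- divisors n | d != n]) q ^ d)%N).
  by apply: leq_sum => d _; exact: nb_monic_irr_le.
apply: uniq_sub_le_big; rewrite ?filter_uniq ?divisors_uniq ?iota_uniq //.
by move=> x y; exact: leq_addr.
Qed.

Lemma card_irreducible n d : (d < n)%N ->
  #|[set g : {poly_n F} | `[< irreducible_poly g >] && (size g == d.+1)]| =
  (q.-1 * nb_monic_irr d)%N.
Proof.
move=> dn; rewrite (card_npoly_set _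
  (fun g => `[< irreducible_poly g >] && (size g == d.+1))).
have <- : size (enum (predC1 (0 : F))) = q.-1 by rewrite -cardE cardC1.
rewrite -(size_allpairs (fun c p => c *: p)); apply/perm_size/uniq_perm.
- exact/filter_uniq/uniq_polys_of_size.
- apply: allpairs_uniq; rewrite ?enum_uniq ?uniq_monic_irr // => -[c p] [e u].
  move=> /allpairsP[[? ?] /= [c0 /monic_irrP[[_ pM] _] [-> ->]]].
  move=> /allpairsP[[? ?] /= [_ /monic_irrP[[_ uM] _] [-> ->]]] /= E.
  have := congr1 lead_coef E; rewrite !lead_coefZ (monicP pM) (monicP uM) !mulr1 => ce.
  by move: c0 E; rewrite ce mem_enum => e0 /(scalerI e0) ->.
move=> g; rewrite mem_filter mem_polys_of_size; apply/idP/allpairsP.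
  move=> /andP[/andP[/asboolP gI /eqP sg] _]; have g0 := irredp_neq0 gI.
  exists (lead_coef g, (lead_coef g)^-1 *: g).
  rewrite mem_enum !inE lead_coef_eq0 g0 scalerA mulfV ?lead_coef_eq0 // scale1r.
  split=> //; apply/monic_irrP; split; first exact: monic_irreducible_scale.
  by rewrite size_scale // invr_eq0 lead_coef_eq0.
move=> [[c p] /= [+ /monic_irrP[[pI _] sp] ->]]; rewrite mem_enum => c0.
rewrite size_scale // sp eqxx dn !andbT.
by apply/asboolP/irreducible_polyZ.
Qed.
End MonicIrreducibles.

(** * Counting truncations *)

Section Truncations.
Variable F : finFieldType.
Implicit Types (b f g B : {poly F}) (m l n N : nat).
Local Notation q := #|F|.

Lemma card_modp_eq B g N : (size g < size B)%N -> ((size B).-1 <= N)%N ->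
  #|[set f : {poly_N F} | (f : {poly F}) %% B == g]| = (q ^ (N - (size B).-1))%N.
Proof.
move=> gB BN; have B0 : B != 0 by rewrite -size_poly_gt0 (leq_trans _ gB).
rewrite (card_npoly_set _ (fun f => f %% B == g)) -size_polys_of_size.
rewrite -[RHS](size_map (fun u => u * B + g)); apply/perm_size/uniq_perm.
- exact/filter_uniq/uniq_polys_of_size.
- by rewrite map_inj_uniq ?uniq_polys_of_size // => u v /= /addIr /(mulIf B0).
move=> f; rewrite mem_filter mem_polys_of_size; apply/andP/mapP.
  move=> [/eqP <- sf]; exists (f %/ B); last exact: divp_eq.
  by rewrite mem_polys_of_size size_divp // leq_sub2r.
move=> [u]; rewrite mem_polys_of_size => su ->; rewrite modp_addl_mul_small //.
split=> //; rewrite (leq_trans (size_polyD _ _)) // geq_max.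
have gN : (size g <= N)%N by move: (size g) (size B) gB BN => d e; lia.
rewrite gN andbT (leq_trans (size_polyMleq _ _)) //.
by move: (size u) (size B) su BN => d e; lia.
Qed.

Lemma dvdp_sub_modp B f g : (size g < size B)%N -> (B %| g - f) = (f %% B == g).
Proof. by move=> gB; rewrite /dvdp modpD modpN modp_small // subr_eq0 eq_sym. Qed.

Definition trunc_modulus b g := b ^+ ((size g).-1 %/ (size b).-1).+1.

Lemma degree_trunc_modulus b g :
  (size (trunc_modulus b g)).-1 = ((size b).-1 * ((size g).-1 %/ (size b).-1).+1)%N.
Proof. exact: size_exp. Qed.

Lemma ltn_size_trunc_modulus b g : (1 < size b)%N ->
  (size g < size (trunc_modulus b g))%N.
Proof.
move=> b1; have /prednK <- : (0 < size (trunc_modulus b g))%N.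
  by rewrite size_poly_gt0 expf_neq0 // -size_poly_gt0 ltnW.
rewrite degree_trunc_modulus ltnS mulnC; case: (size g) => [|d] //=.
by rewrite -ltn_divLR //; case: size b1 => [|[]].
Qed.

Lemma truncL_card_modp b f N : (1 < size b)%N -> (size f <= N)%N ->
  truncL b f = #|[set g : {poly_N F} |
    `[< irreducible_poly g >] && (f %% trunc_modulus b g == g)]|.
Proof.
move=> b1 fN; pose truncates g := f %% trunc_modulus b g == g.
rewrite [RHS](card_npoly_set _ (fun g => `[< irreducible_poly g >] && truncates g)).
rewrite /truncL (card_npoly_set _ (fun g => `[< irreducible_poly g >] &&
  (trunc_modulus b g %| g - f))).
apply/perm_size/uniq_perm; try exact/filter_uniq/uniq_polys_of_size.
move=> g; rewrite !mem_filter !mem_polys_of_size dvdp_sub_modp ?ltn_size_trunc_modulus //.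
rewrite -/(truncates g); case truncates_g: (truncates g); last by rewrite !andbF.
have gf : (size g <= size f)%N by rewrite -(eqP truncates_g) leq_modp.
by rewrite gf (leq_trans gf fN).
Qed.

Lemma sum_irreducible_degree N (G : nat -> nat) :
  (\sum_(g : {poly_N F} | `[< irreducible_poly g >]) G (size g).-1 =
   \sum_(h < N) q.-1 * nb_monic_irr F h * G h)%N.
Proof.
case: N => [|N].
  rewrite big_ord0 big1 // => g /asboolP[]; have := size_npoly g.
  by case: size.
have degN (g : {poly_N.+1 F}) : ((size g).-1 < N.+1)%N by have := size_npoly g; lia.
rewrite (partition_big (fun g : {poly_N.+1 F} => Ordinal (degN g)) xpredT) //=.
apply: eq_bigr => h _; rewrite -(card_irreducible F (ltn_ord h)) -sum_nat_const.
apply: eq_big => [g|g /andP[_ /eqP <-] //]; rewrite inE -val_eqE /=.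
by case: asboolP => //= -[g1 _]; case: size g1.
Qed.

Lemma sum_truncL b m l : size b = m.+1 -> (0 < m)%N ->
  (\sum_(f : {poly_(m * l) F}) truncL b f =
   \sum_(h < m * l) q.-1 * nb_monic_irr F h * q ^ (m * l - m * (h %/ m).+1))%N.
Proof.
move=> sb m0; have b1 : (1 < size b)%N by rewrite sb.
rewrite -(sum_irreducible_degree _ (fun h => q ^ (m * l - m * (h %/ m).+1))%N).
under eq_bigr do rewrite (truncL_card_modp b1 (size_npoly _)) -sum1dep_card.
rewrite (exchange_big_dep (fun g : {poly_(m * l) F} => `[< irreducible_poly g >])) /=.
  apply: eq_bigr => g gI; have := degree_trunc_modulus b g; rewrite sb /= => <-.
  rewrite -(@card_modp_eq _ g) ?ltn_size_trunc_modulus //.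
    by rewrite -sum1dep_card; apply: eq_bigl => f; rewrite gI.
  have gN := size_npoly g; have /asboolP[g1 _] := gI.
  rewrite degree_trunc_modulus sb /= leq_mul2l ltn_divLR // [(l * m)%N]mulnC.
  by apply/orP; right; move: g1 gN; case: size => //= d _ ->.
by move=> f g _ /andP[].
Qed.
End Truncations.

(** * Block sums *)

Section BlockSums.
Variable R : comPzRingType.
Implicit Types (w a : nat -> R) (k l m r : nat).

(* For fixed [k] the argument of [a] runs downwards through the block
   [m k, ..., m k + m - 1]; the indices [k] and [r] both start at [0]. *)
Definition block_sum w a m l : R :=
  \sum_(k < l) \sum_(r < m) w r * a (m * k.+1 - r.+1)%N.

Lemma block_sum1 a m l : block_sum (fun=> 1) a m l = \sum_(h < m * l) a h.
Proof.
elim: l => [|l IHl]; first by rewrite muln0 /block_sum !big_ord0.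
rewrite mulnSr big_split_ord -IHl [LHS]big_ord_recr /=; congr (_ + _).
rewrite [RHS](reindex_inj rev_ord_inj) /=; apply: eq_bigr => r _.
by rewrite mul1r mulnSr addnBA.
Qed.

Lemma block_sum_delta a m l : (0 < m)%N ->
  block_sum (fun r => (r == 0)%:R) a m l = \sum_(k < l) a (m * k.+1 - 1)%N.
Proof.
case: m => // m _; apply: eq_bigr => k _; rewrite big_ord_recl mul1r big1 ?addr0 //.
by move=> r _; rewrite mul0r.
Qed.

Lemma sum_pred_multiples a m l : (0 < m)%N ->
  \sum_(h < m * l | (m %| h.+1)%N) a h = \sum_(k < l) a (m * k.+1 - 1)%N.
Proof.
move=> m0; rewrite -(block_sum_delta a l m0) big_mkcond.
rewrite -(block_sum1 (fun h => if (m %| h.+1)%N then a h else 0)).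
apply: eq_bigr => k _; apply: eq_bigr => r _; rewrite mul1r.
have rk : (r < m * k.+1)%N by rewrite (leq_trans (ltn_ord r)) // leq_pmulr.
rewrite subnSK // dvdn_subr ?dvdn_mulr ?(ltnW rk) //.
case: (posnP r) => [-> |r0]; first by rewrite dvdn0 mul1r.
by rewrite gtnNdvd // mul0r.
Qed.

Lemma block_sumBl w w' a m l :
  block_sum (fun r => w r - w' r) a m l = block_sum w a m l - block_sum w' a m l.
Proof.
rewrite -sumrB; apply: eq_bigr => k _; rewrite -sumrB.
by apply: eq_bigr => r _; rewrite mulrBl.
Qed.

Lemma block_sumBr w a a' m l :
  block_sum w (fun h => a h - a' h) m l = block_sum w a m l - block_sum w a' m l.
Proof.
rewrite -sumrB; apply: eq_bigr => k _; rewrite -sumrB.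
by apply: eq_bigr => r _; rewrite mulrBr.
Qed.
End BlockSums.

Section BlockSumExpansion.
Variable R : realFieldType.
Implicit Types (w : nat -> R) (h i j k l m r s : nat).

Lemma inv_expansion (K : fieldType) (c y : K) j : c != 0 -> c + y != 0 ->
  c^-1 - \sum_(i < j) y ^+ i / (c + y) ^+ i.+1 = (y / (c + y)) ^+ j / c.
Proof.
move=> c0 cy0; elim: j => [|j IHj]; first by rewrite big_ord0 subr0 mul1r.
rewrite big_ord_recr opprD addrA {}IHj /= !expr_div_n !exprS.
have : (c + y) ^+ j != 0 by rewrite expf_neq0.
move: (y ^+ j) ((c + y) ^+ j) => a b b0.
by field; rewrite c0 cy0 b0.
Qed.

(* At [h = 0 < r] the left-hand side is [j / r], as [0^-1 = 0]. *)
Lemma inv_expansion_le h r j :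
  `|h%:R^-1 - \sum_(i < j) r%:R ^+ i / (h + r)%:R ^+ i.+1|
  <= r%:R ^+ j * (r + j).+1%:R / (h + r)%:R ^+ j.+1 :> R.
Proof.
have [->|h0] := posnP h.
  have [->|r0] := posnP r.
    rewrite invr0 big1 ?subrr ?normr0 ?mulr_ge0 ?invr_ge0 ?exprn_ge0 //.
    by move=> i _; rewrite addn0 exprS mul0r invr0 mulr0.
  have powers_cancel i : r%:R ^+ i / r%:R ^+ i.+1 = r%:R^-1 :> R.
    by rewrite exprSr invfM mulVKf // expf_neq0 // pnatr_eq0 -lt0n.
  rewrite invr0 add0r normrN add0n.
  under eq_bigr do rewrite powers_cancel.
  rewrite sumr_const card_ord mulrAC powers_cancel mulr_natr.
  rewrite ger0_norm ?mulrn_wge0 ?invr_ge0 //.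
  by rewrite ler_wpMn2l ?invr_ge0 // leqW // leq_addl.
have hR : 0 < h%:R :> R by rewrite ltr0n.
have xR : 0 < (h + r)%:R :> R by rewrite ltr0n addn_gt0 h0.
rewrite natrD inv_expansion -?natrD ?gt_eqF // ger0_norm; last first.
  by rewrite mulr_ge0 ?invr_ge0 ?exprn_ge0 ?divr_ge0.
rewrite expr_div_n exprSr invfM -!mulrA ler_wpM2l ?exprn_ge0 //.
rewrite [leRHS]mulrCA ler_wpM2l ?invr_ge0 ?exprn_ge0 //.
rewrite ler_pdivlMr // mulrC ler_pdivrMr // -natrM ler_nat.
by case: h h0 {hR xR} => // h _; nia.
Qed.

Definition gen_harmonic s l : R := \sum_(k < l) (k.+1%:R ^+ s)^-1.

Lemma gen_harmonic_nat s l :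
  \sum_(1 <= h < l.+1) (h%:R ^+ s)^-1 = gen_harmonic s l.
Proof. by rewrite big_add1 big_mkord. Qed.

Lemma gen_harmonic_ge0 s l : 0 <= gen_harmonic s l.
Proof. by apply: sumr_ge0 => k _; rewrite invr_ge0 exprn_ge0. Qed.

Lemma gen_harmonic_le2 s l : (1 < s)%N -> gen_harmonic s l <= 2.
Proof.
move=> s1; case: l => [|l]; first by rewrite /gen_harmonic big_ord0.
apply: (@le_trans _ _ (2 - l.+1%:R^-1)); last by rewrite gerBl invr_ge0.
elim: l => [|l IHl]; first by rewrite /gen_harmonic big_ord1 expr1n invr1; lra.
rewrite /gen_harmonic big_ord_recr /=.
have telescoping : (l.+2%:R ^+ s)^-1 <= l.+1%:R^-1 - l.+2%:R^-1 :> R.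
  apply: (@le_trans _ _ (l.+2%:R ^+ 2)^-1).
    by rewrite lef_pV2 ?posrE ?exprn_gt0 // ler_weXn2l // ler1n.
  have a0 : 0 < l.+1%:R :> R by rewrite ltr0n.
  rewrite -[l.+2%:R]natr1; move: (l.+1%:R) a0 => a a0.
  rewrite -subr_ge0.
  have -> : a^-1 - (a + 1)^-1 - ((a + 1) ^+ 2)^-1 = a^-1 * ((a + 1) ^+ 2)^-1.
    by field; lra.
  by rewrite mulr_ge0 // invr_ge0 ?exprn_ge0 //; lra.
by apply: le_trans (lerD IHl telescoping) _; rewrite addrA subrK.
Qed.

Lemma block_sum_inv_expansion w j m l :
  `|block_sum w (fun h => h%:R^-1) m l
    - \sum_(i < j) (\sum_(r < m) w r * r.+1%:R ^+ i) / m%:R ^+ i.+1 * gen_harmonic i.+1 l|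
  <= (\sum_(r < m) `|w r| * (r.+1%:R ^+ j * (r.+1 + j).+1%:R)) / m%:R ^+ j.+1
     * gen_harmonic j.+1 l.
Proof.
pose E k r : R := (m * k.+1 - r.+1)%:R^-1
  - \sum_(i < j) r.+1%:R ^+ i / (m * k.+1)%:R ^+ i.+1.
have inv_pow k i : ((m * k.+1)%:R ^+ i)^-1 = (m%:R ^+ i)^-1 * (k.+1%:R ^+ i)^-1 :> R.
  by rewrite natrM exprMn invfM.
have -> : block_sum w (fun h => h%:R^-1) m l
    - \sum_(i < j) (\sum_(r < m) w r * r.+1%:R ^+ i) / m%:R ^+ i.+1 * gen_harmonic i.+1 l
    = \sum_(k < l) \sum_(r < m) w r * E k r.
  under [X in _ - X]eq_bigr do rewrite mulr_sumr.
  rewrite exchange_big -sumrB; apply: eq_bigr => k _ /=.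
  under [X in _ - X]eq_bigr do rewrite -mulrA -inv_pow mulr_suml.
  rewrite exchange_big -sumrB; apply: eq_bigr => r _ /=.
  by rewrite mulrBr mulr_sumr; congr (_ - _); apply: eq_bigr => i _; rewrite mulrA.
rewrite mulr_sumr (le_trans (ler_norm_sum _ _ _)) //; apply: ler_sum => k _.
rewrite -mulrA -inv_pow mulr_suml (le_trans (ler_norm_sum _ _ _)) //.
apply: ler_sum => r _; rewrite normrM -mulrA ler_wpM2l // /E.
have rk : (r < m * k.+1)%N by rewrite (leq_trans (ltn_ord r)) // leq_pmulr.
by have := inv_expansion_le (m * k.+1 - r.+1) r.+1 j; rewrite subnK.
Qed.
End BlockSumExpansion.

(** * Geometric weights *)

Section GeometricMoments.
Variable R : realFieldType.
Implicit Types (x : R) (j m n r : nat).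

Lemma sum_geometric_compl x m : \sum_(r < m) geometric (1 - x) x r = 1 - x ^+ m.
Proof. by rewrite -mulr_sumr -opprB mulNr -subrX1 opprB. Qed.

Lemma sum_geometric_compl_linear x m : x != 1 ->
  \sum_(r < m) geometric (1 - x) x r * r.+1%:R
  = (1 - x)^-1 - x ^+ m * (m%:R + (1 - x)^-1).
Proof.
move=> x_neq1; have x_compl_neq0 : 1 - x != 0 by rewrite subr_eq0 eq_sym.
elim: m => [|m IHm]; first by rewrite big_ord0; field.
by rewrite big_ord_recr {}IHm /= exprS -[m.+1%:R]natr1; field.
Qed.

Lemma sum_expr_le x n : 0 <= x < 1 -> \sum_(r < n) x ^+ r <= (1 - x)^-1.
Proof.
move=> /andP[x0 x1]; rewrite -[_^-1]mul1r ler_pdivlMr ?subr_gt0 // mulrC mulr_sumr.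
by rewrite sum_geometric_compl gerBl exprn_ge0.
Qed.

Lemma sum_bin_expr_le x j n : 0 <= x < 1 ->
  \sum_(r < n) 'C(r + j, j)%:R * x ^+ r <= (1 - x) ^- j.+1.
Proof.
move=> xP; have /andP[x0 x1] := xP; elim: j => [|j IHj].
  by under eq_bigr do rewrite bin0 mul1r; exact: sum_expr_le.
rewrite exprSr invfM ler_pdivlMr ?subr_gt0 //; apply: le_trans IHj.
have -> : (\sum_(r < n) 'C(r + j.+1, j.+1)%:R * x ^+ r) * (1 - x) =
    \sum_(r < n) 'C(r + j, j)%:R * x ^+ r - 'C(n + j, j.+1)%:R * x ^+ n.
  elim: n => [|n IHn]; first by rewrite !big_ord0 bin_small // !mul0r subrr.
  rewrite !big_ord_recr /= mulrDl {}IHn addSn addnS !binS !natrD exprS.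
  by ring.
by rewrite gerBl mulr_ge0 ?exprn_ge0.
Qed.

Lemma cubic_le_bin3 j r : (j <= 2)%N ->
  (r.+1 ^ j * (r.+1 + j).+1 <= 6 * 'C(r + 3, 3))%N.
Proof.
have -> : (6 * 'C(r + 3, 3) = r.+1 * r.+2 * r.+3)%N.
  by rewrite mulnC (bin_ffact _ 3) addn3 !ffactnS /= muln1; lia.
by case: j => [|[|[|]]] // _; nia.
Qed.

Section SmallRatio.
Variable x : R.
Hypothesis x_bounds : 0 <= x <= 2^-1.

Lemma geometric_moment_le j m : (j <= 2)%N ->
  \sum_(r < m) `|geometric (1 - x) x r| * (r.+1%:R ^+ j * (r.+1 + j).+1%:R) <= 48.
Proof.
move=> j_le2; have /andP[x0 xh] := x_bounds.
have x_lt1 : 0 <= x < 1 by rewrite x0; lra.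
have compl_gt0 : 0 < 1 - x by lra.
apply: (@le_trans _ _ ((1 - x) * (6 * \sum_(r < m) 'C(r + 3, 3)%:R * x ^+ r))).
  rewrite !mulr_sumr; apply: ler_sum => r _.
  rewrite ger0_norm ?geometric_ge0 ?(ltW compl_gt0) //= -mulrA.
  rewrite ler_wpM2l ?(ltW compl_gt0) //.
  rewrite mulrC mulrA ler_wpM2r ?exprn_ge0 // -natrX -!natrM ler_nat.
  exact: cubic_le_bin3.
apply: (@le_trans _ _ ((1 - x) * (6 * (1 - x) ^- 4))).
  by rewrite ler_wpM2l ?(ltW compl_gt0) // ler_wpM2l // sum_bin_expr_le.
rewrite mulrCA -exprVn exprS mulVKf ?gt_eqF //.
have inv_le2 : (1 - x)^-1 <= 2 by rewrite -[2]invrK lef_pV2 ?posrE //; lra.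
have : (1 - x)^-1 ^+ 3 <= 2 ^+ 3.
  by rewrite lerXn2r ?nnegrE ?invr_ge0 ?(ltW compl_gt0).
by lra.
Qed.

Lemma geometric_sub_delta_moment_le m :
  \sum_(r < m) `|geometric (1 - x) x r - (r == 0 :> nat)%:R| * r.+2%:R <= 50 * x.
Proof.
have /andP[x0 xh] := x_bounds.
case: m => [|m]; first by rewrite big_ord0 mulr_ge0.
rewrite big_ord_recl /= mulr1 addrAC subrr add0r normrN ger0_norm //.
have tail_le : \sum_(r < m) `|geometric (1 - x) x r.+1 - 0| * r.+3%:R <= x * 48.
  apply: le_trans (ler_wpM2l x0 (geometric_moment_le m (isT : (1 <= 2)%N))).
  rewrite mulr_sumr; apply: ler_sum => r _.
  rewrite subr0 /= exprS [(1 - x) * _]mulrCA normrM (ger0_norm x0) -mulrA ler_wpM2l //.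
  by rewrite ler_wpM2l // expr1 addn1 ler_peMl // ler1n.
apply: le_trans (lerD (lexx _) tail_le) _; lra.
Qed.

Local Notation geometric_inv_sum := (block_sum (geometric (1 - x) x) (fun h => h%:R^-1)).

Lemma geometric_inv_sum_expansion j m l : (0 < j <= 2)%N ->
  `|geometric_inv_sum m l - \sum_(i < j)
      (\sum_(r < m) geometric (1 - x) x r * r.+1%:R ^+ i) / m%:R ^+ i.+1
      * gen_harmonic R i.+1 l| <= 96 / m%:R ^+ j.+1.
Proof.
move=> /andP[j_gt0 j_le2]; apply: le_trans (block_sum_inv_expansion _ _ _ _) _.
have -> : 96 / m%:R ^+ j.+1 = 48 / m%:R ^+ j.+1 * 2 :> R by lra.
apply: ler_pM; rewrite ?gen_harmonic_ge0 ?gen_harmonic_le2 //.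
  by rewrite divr_ge0 ?exprn_ge0 // sumr_ge0.
by rewrite ler_wpM2r ?invr_ge0 ?exprn_ge0 ?geometric_moment_le.
Qed.

Lemma geometric_inv_sum_order1 m l :
  `|geometric_inv_sum m l - (1 - x ^+ m) / m%:R * gen_harmonic R 1 l|
  <= 96 / m%:R ^+ 2.
Proof.
have := geometric_inv_sum_expansion m l (isT : (0 < 1 <= 2)%N).
by rewrite big_ord1; under eq_bigr do rewrite mulr1; rewrite sum_geometric_compl.
Qed.

Lemma geometric_inv_sum_order2 m l :
  `|geometric_inv_sum m l - ((1 - x ^+ m) / m%:R * gen_harmonic R 1 l
      + ((1 - x)^-1 - x ^+ m * (m%:R + (1 - x)^-1)) / m%:R ^+ 2 * gen_harmonic R 2 l)|
  <= 96 / m%:R ^+ 3.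
Proof.
have x1 : x != 1 by have /andP[_ xh] := x_bounds; rewrite lt_eqF //; lra.
have := geometric_inv_sum_expansion m l (isT : (0 < 2 <= 2)%N).
rewrite big_ord_recl big_ord1 /=; under eq_bigr do rewrite mulr1.
by rewrite sum_geometric_compl sum_geometric_compl_linear.
Qed.

(* The first weight [1 - x] is close to [1] and the others are [O(x)]: the weights are
   a perturbation of the indicator of [r = 0]. *)
Lemma geometric_inv_sum_leading m l : (0 < m)%N ->
  `|geometric_inv_sum m l - \sum_(k < l) (m * k.+1 - 1)%:R^-1|
  <= 50 * x / m%:R * gen_harmonic R 1 l.
Proof.
move=> m0; rewrite -(block_sum_delta (fun h => h%:R^-1) l m0) -block_sumBl.
have := block_sum_inv_expansion
  (fun r => geometric (1 - x) x r - (r == 0)%:R) 0 m l.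
rewrite big_ord0 subr0 => /le_trans; apply.
rewrite ler_wpM2r ?gen_harmonic_ge0 // ler_wpM2r ?invr_ge0 ?exprn_ge0 //.
under eq_bigr do rewrite mul1r addn0.
exact: geometric_sub_delta_moment_le.
Qed.
End SmallRatio.

Section ErrorSum.
Variables (s : R) (d : nat -> R).
Hypothesis s_bounds : 0 <= s < 1.
Hypothesis d_bounds : forall h, 0 <= d h <= 2 * s ^+ h.
Hypotheses (d0 : d 0%N = 0) (d1 : d 1%N = 0).

Local Notation w := (geometric (1 - s ^+ 2) (s ^+ 2)).

Let s_ge0 : 0 <= s. Proof. by have /andP[] := s_bounds. Qed.
Let s_le1 : s <= 1. Proof. by have /andP[_ /ltW] := s_bounds. Qed.

Let d_ge0 h : 0 <= d h. Proof. by have /andP[] := d_bounds h. Qed.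
Let d_le h : d h <= 2 * s ^+ h. Proof. by have /andP[] := d_bounds h. Qed.

Let weight_bounds r : 0 <= w r <= (s ^+ 2) ^+ r.
Proof.
have s2 : 0 <= s ^+ 2 <= 1 by rewrite exprn_ge0 ?exprn_ile1.
have /andP[s2_ge0 s2_le1] := s2.
by rewrite geometric_ge0 ?subr_ge0 //= ler_piMl ?exprn_ge0 // gerBl.
Qed.

Lemma geometric_error_sum_ge0 m l : 0 <= block_sum w d m l.
Proof.
apply: sumr_ge0 => k _; apply: sumr_ge0 => r _.
by have /andP[w_ge0 _] := weight_bounds r; rewrite mulr_ge0.
Qed.

Lemma geometric_error_sum_le_sqr m l : block_sum w d m l <= 2 * s ^+ 2 / (1 - s).
Proof.
apply: (@le_trans _ _ (\sum_(h < (m * l).+2) d h)).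
  rewrite 2!big_ord_recr /= -block_sum1 -addrA -[leLHS]addr0 lerD //.
    apply: ler_sum => k _; apply: ler_sum => r _; have /andP[_ w1] := weight_bounds r.
    by rewrite ler_wpM2r // (le_trans w1) // exprn_ile1 ?exprn_ge0 ?exprn_ile1.
  by rewrite addr_ge0.
rewrite 2!big_ord_recl /= d0 d1 !add0r.
apply: le_trans (ler_wpM2l _ (sum_expr_le (m * l) s_bounds)); last first.
  by rewrite mulr_ge0 ?exprn_ge0.
rewrite mulr_sumr; apply: ler_sum => h _; rewrite -mulrA -exprD; exact: d_le.
Qed.

Lemma geometric_error_sum_le_exp m l : (0 < m)%N ->
  block_sum w d m l <= 2 * s ^+ m.-1 / (1 - s) ^+ 2.
Proof.
case: m => // m _.
have -> : 2 * s ^+ m / (1 - s) ^+ 2 = 2 * s ^+ m * ((1 - s)^-1 * (1 - s)^-1).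
  by rewrite expr2 invfM.
have sum_ge0 n : 0 <= \sum_(i < n) s ^+ i by rewrite sumr_ge0 // => i _; exact: exprn_ge0.
apply: (@le_trans _ _
    (2 * s ^+ m * ((\sum_(k < l) s ^+ k) * \sum_(r < m.+1) s ^+ r))); last first.
  by rewrite ler_wpM2l ?mulr_ge0 ?exprn_ge0 // ler_pM ?sum_expr_le.
rewrite mulr_suml mulr_sumr; apply: ler_sum => k _.
rewrite !mulr_sumr; apply: ler_sum => r _.
have /andP[w_ge0 w_le] := weight_bounds r.
apply: le_trans (ler_pM w_ge0 (d_ge0 _) w_le (d_le _)) _.
rewrite mulrCA -!mulrA ler_wpM2l // -exprM -!exprD ler_wiXn2l //.
by have := ltn_ord r; nia.
Qed.
End ErrorSum.
End GeometricMoments.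

(** * Harmonic sums and logarithms *)

Section HarmonicLogarithm.
Variable R : realType.
Implicit Types (x s : R) (k l m : nat).

Lemma ln_succ_bounds k :
  k.+2%:R^-1 <= ln (k.+2%:R : R) - ln k.+1%:R <= k.+1%:R^-1.
Proof.
have k1 : 0 < k.+1%:R :> R by rewrite ltr0n.
have k2 : 0 < k.+2%:R :> R by rewrite ltr0n.
apply/andP; split.
  rewrite -lerN2 opprB -ln_div ?posrE //.
  have -> : k.+1%:R / k.+2%:R = 1 + - k.+2%:R^-1 :> R.
    by rewrite -[k.+1%:R](addrK 1) natr1 mulrBl mulfV ?gt_eqF ?mul1r.
  by rewrite le_ln1Dx // ltrN2 invf_lt1 // ltr1n.
rewrite -ln_div ?posrE //.
have -> : k.+2%:R / k.+1%:R = 1 + k.+1%:R^-1 :> R.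
  by rewrite -natr1 mulrDl mulfV ?gt_eqF ?mul1r.
by rewrite le_ln1Dx // (lt_trans (ltrN10 _)) // invr_gt0.
Qed.

Lemma harmonic_sub_ln_bounds l : (0 < l)%N ->
  0 <= gen_harmonic R 1 l - ln l%:R <= 1.
Proof.
case: l => // l _; suff : l.+1%:R^-1 <= gen_harmonic R 1 l.+1 - ln l.+1%:R <= 1.
  by move=> /andP[lower ->]; rewrite (le_trans _ lower) // invr_ge0.
elim: l => [|l /andP[IHge IHle]].
  by rewrite /gen_harmonic big_ord1 ln1 expr1 invr1 subr0 lexx.
have /andP[ln_ge ln_le] := ln_succ_bounds l.
rewrite [gen_harmonic _ _ _]big_ord_recr /= -/(gen_harmonic R 1 l.+1) expr1.
move: (gen_harmonic _ _ _) (ln l.+1%:R) (ln l.+2%:R) l.+1%:R^-1 l.+2%:R^-1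
  IHge IHle ln_ge ln_le => H L L' a a' *.
by apply/andP; split; lra.
Qed.

Lemma geometric_correction_le x m l : 0 <= x <= 2^-1 -> (0 < m)%N -> (0 < l)%N ->
  `|x ^+ m / m%:R * gen_harmonic R 1 l
    + x ^+ m * (m%:R + (1 - x)^-1) / m%:R ^+ 2 * gen_harmonic R 2 l|
  <= 7 * (x ^+ m * (1 + ln l%:R)).
Proof.
move=> /andP[x0 xh] m0 l0; set u := (1 - x)^-1.
have /andP[u_ge0 u_le2] : 0 <= u <= 2.
  by rewrite /u invr_ge0 -[2]invrK lef_pV2 ?posrE; lra.
have m_inv_le1 : m%:R^-1 <= 1 :> R by rewrite invf_le1 ?ltr0n // ler1n.
have /andP[_ H1] := harmonic_sub_ln_bounds l0; have H1_ge0 := gen_harmonic_ge0 R 1 l.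
have H2 := gen_harmonic_le2 R l (isT : (1 < 2)%N); have H2_ge0 := gen_harmonic_ge0 R 2 l.
have L_ge0 : 0 <= ln l%:R :> R by rewrite ln_ge0 // ler1n.
have -> : x ^+ m / m%:R * gen_harmonic R 1 l
    + x ^+ m * (m%:R + u) / m%:R ^+ 2 * gen_harmonic R 2 l
    = x ^+ m * (m%:R^-1 * (gen_harmonic R 1 l + (1 + u * m%:R^-1) * gen_harmonic R 2 l)).
  by field; rewrite pnatr_eq0 -lt0n.
have coeff_ge0 : 0 <= 1 + u * m%:R^-1 by rewrite addr_ge0 ?divr_ge0.
have coeff_le : 1 + u * m%:R^-1 <= 3.
  by have := ler_pM u_ge0 _ u_le2 m_inv_le1; rewrite invr_ge0 ler0n => /(_ isT); lra.
have bracket_ge0 : 0 <= gen_harmonic R 1 l + (1 + u * m%:R^-1) * gen_harmonic R 2 l.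
  by rewrite addr_ge0 ?mulr_ge0.
rewrite ger0_norm ?mulr_ge0 ?exprn_ge0 ?invr_ge0 // [leRHS]mulrCA ler_wpM2l ?exprn_ge0 //.
apply: (le_trans (ler_piMl bracket_ge0 m_inv_le1)).
by have := ler_pM coeff_ge0 H2_ge0 coeff_le H2; lra.
Qed.

Lemma exponential_error_le s m l : 0 < s <= 1 -> (0 < m)%N -> (0 < l)%N ->
  s ^+ m.-1 * (1 + ln (m * l)%:R)
  <= 6 * ((m%:R ^+ 3)^-1 + (s ^+ 2)^-1 * ln (m * l)%:R ^+ 2 * s ^+ m).
Proof.
move=> /andP[s0 s1] m0 l0.
have [|ml2] := leqP (m * l) 1.
  case: m l m0 l0 => [|[|m]] [|[|l]] // _ _ _.
  by rewrite muln1 ln1 expr1n invr1 !(mulr0, mul0r, addr0, mul1r); lra.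
set L := ln _; have L2 : 2^-1 <= L.
  have /andP[ln2 _] := ln_succ_bounds 0; rewrite ln1 subr0 in ln2.
  by rewrite (le_trans ln2) // ler_ln ?posrE ?ltr0n ?ler_nat // (leq_trans _ ml2).
have s_pow : s ^+ m.-1 <= (s ^+ 2)^-1 * s ^+ m.
  rewrite ler_pdivlMl ?exprn_gt0 // -exprD ler_wiXn2l ?(ltW s0) //.
  by case: m m0 {ml2 L L2}.
have cube_ge0 : 0 <= (m%:R ^+ 3)^-1 :> R by rewrite invr_ge0 exprn_ge0.
rewrite [leRHS]mulrDr -[leLHS]add0r lerD ?mulr_ge0 // [_ * s ^+ m]mulrAC [leRHS]mulrCA.
by apply: ler_pM; rewrite ?exprn_ge0 ?(ltW s0) //; nra.
Qed.
End HarmonicLogarithm.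

(** * The mean number of truncations *)

Lemma divn_block m k r : (r < m)%N -> ((m * k.+1 - r.+1) %/ m = k)%N.
Proof. by nia. Qed.

Lemma sum_inv_residue (R : realType) m l : (0 < m)%N -> (0 < l)%N ->
  \sum_(1 <= h < m * l | (h%:Z == -1 %[mod m%:Z])%Z) h%:R^-1 =
  \sum_(k < l) (m * k.+1 - 1)%:R^-1 :> R.
Proof.
move=> m0 l0; rewrite -(sum_pred_multiples (fun h => h%:R^-1 : R)) //.
rewrite -(big_mkord (fun h => m %| h.+1)%N (fun h => h%:R^-1 : R)).
rewrite big_ltn_cond ?muln_gt0 ?m0 // invr0 add0r if_same.
by apply: eq_bigl => h; rewrite eqz_mod_dvd opprK -PoszD addn1.
Qed.

Section MeanTruncations.
Variables (R : realType) (F : finFieldType).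
Implicit Types (h k l m n : nat).

Local Notation Q := (#|F|%:R : R).
Local Notation x := (Q^-1).
Local Notation s := (Num.sqrt x).

Let Q_gt0 : 0 < Q. Proof. by rewrite ltr0n ltnW ?finNzRing_gt1. Qed.
Let x_gt0 : 0 < x. Proof. by rewrite invr_gt0. Qed.
Let x_bounds : 0 <= x <= 2^-1.
Proof. by rewrite (ltW x_gt0) lef_pV2 ?posrE // ler_nat finNzRing_gt1. Qed.
Let s_sqr : s ^+ 2 = x. Proof. by rewrite sqr_sqrtr ?ltW. Qed.
Let s_gt0 : 0 < s. Proof. by rewrite sqrtr_gt0. Qed.
Let s_le : s <= 3 / 4.
Proof.
have /andP[_ xh] := x_bounds.
by rewrite -(@ler_pXn2r _ 2) ?nnegrE ?s_sqr //; lra.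
Qed.
Let s_bounds : 0 <= s < 1. Proof. by rewrite sqrtr_ge0; have := s_le; lra. Qed.

Definition irr_density h : R := (nb_monic_irr F h)%:R * x ^+ h.

Lemma half_exp_le h : Q ^+ h./2 * x ^+ h <= s ^+ h.
Proof.
have /andP[_ /ltW s_le1] := s_bounds.
have -> : x ^+ h = s ^+ h * s ^+ h by rewrite -exprMn -expr2 s_sqr.
rewrite mulrA ler_piMl ?exprn_ge0 ?(ltW s_gt0) //.
apply: (@le_trans _ _ (Q ^+ h./2 * x ^+ h./2)); last first.
  by rewrite -exprMn mulfV ?expr1n // gt_eqF.
rewrite ler_wpM2l ?exprn_ge0 // -[X in _ <= X ^+ _]s_sqr -exprM mul2n.
by rewrite ler_wiXn2l ?(ltW s_gt0) // -[leqRHS]odd_double_half leq_addl.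
Qed.

Lemma inv_sub_irr_density_bounds h : 0 <= h%:R^-1 - irr_density h <= 2 * s ^+ h.
Proof.
rewrite /irr_density; have [->|h0] := posnP h.
  by rewrite nb_monic_irr0 mul0r invr0 subrr lexx expr0 mulr1 ler0n.
have hR : 0 < h%:R :> R by rewrite ltr0n.
have count_le : h%:R * (nb_monic_irr F h)%:R <= Q ^+ h.
  by rewrite -natrM -natrX ler_nat nb_monic_irr_le.
have count_ge : Q ^+ h <= h%:R * (nb_monic_irr F h)%:R + 2 * Q ^+ h./2.
  by rewrite -!natrX -!natrM -natrD ler_nat nb_monic_irr_ge.
have xh0 : 0 < x ^+ h by rewrite exprn_gt0.
have Qx : Q ^+ h * x ^+ h = 1 by rewrite -exprMn mulfV ?expr1n // gt_eqF.
have -> : h%:R^-1 - (nb_monic_irr F h)%:R * x ^+ h =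
    (Q ^+ h - h%:R * (nb_monic_irr F h)%:R) * x ^+ h / h%:R.
  by rewrite mulrBl Qx; field; rewrite gt_eqF.
rewrite divr_ge0 ?mulr_ge0 ?subr_ge0 ?(ltW xh0) //= ler_pdivrMr //.
apply: (@le_trans _ _ (2 * s ^+ h)); last first.
  by rewrite ler_peMr ?mulr_ge0 ?exprn_ge0 ?(ltW s_gt0) // ler1n.
apply: (@le_trans _ _ (2 * Q ^+ h./2 * x ^+ h)); last first.
  by rewrite -mulrA ler_wpM2l // half_exp_le.
by rewrite ler_wpM2r ?(ltW xh0) // lerBlDl.
Qed.

Lemma irr_density1 : irr_density 1 = 1.
Proof. by rewrite /irr_density nb_monic_irr1 mulfV // gt_eqF. Qed.

Lemma mean_truncL_block_sum (b : {poly F}) m l : size b = m.+1 -> (0 < m)%N ->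
  mean_truncL R b l = block_sum (geometric (1 - x) x) irr_density m l.
Proof.
move=> sb m0; rewrite /mean_truncL sb /= -natr_sum sum_truncL // natr_sum mulr_sumr.
pose a h : R := (Q - 1) * (nb_monic_irr F h)%:R / Q ^+ (m * (h %/ m).+1).
transitivity (\sum_(h < m * l) a h).
  apply: eq_bigr => h _; rewrite !natrM natrX -subn1 natrB ?(ltnW (finNzRing_gt1 F)) //.
  have block_le : (m * (h %/ m).+1 <= m * l)%N.
    by rewrite leq_mul2l ltn_divLR // [(l * m)%N]mulnC ltn_ord orbT.
  rewrite mulrC /a -!mulrA; congr (_ * (_ * _)).
  by rewrite -[X in _ / _ ^+ X](subnK block_le) exprD invfM mulVKf // expf_neq0 // gt_eqF.
rewrite -block_sum1; apply: eq_bigr => k _; apply: eq_bigr => r _.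
have block_split : (m * k.+1 = (m * k.+1 - r.+1) + r.+1)%N.
  by rewrite subnK // (leq_trans (ltn_ord r)) // leq_pmulr.
rewrite mul1r /a divn_block // [X in Q ^+ X]block_split exprD exprS /irr_density /= !exprVn.
set n := (_ - _)%N; have : Q ^+ n != 0 by rewrite expf_neq0 // gt_eqF.
have : Q ^+ r != 0 by rewrite expf_neq0 // gt_eqF.
by move: (Q ^+ n) (Q ^+ r) => u v u0 v0; field; rewrite u0 v0 gt_eqF.
Qed.

Section Estimates.
Variables (b : {poly F}) (m l : nat).
Hypotheses (size_b : size b = m.+1) (m_gt0 : (0 < m)%N) (l_gt0 : (0 < l)%N).

Local Notation mean := (mean_truncL R b l).
Local Notation inv_sum := (block_sum (geometric (1 - x) x) (fun h => h%:R^-1) m l).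
Local Notation H := (gen_harmonic R).

Let mR_gt0 : 0 < m%:R :> R. Proof. by rewrite ltr0n. Qed.
Let m_inv_le1 : m%:R^-1 <= 1 :> R. Proof. by rewrite invf_le1 // ler1n. Qed.
Let ln_l_ge0 : 0 <= ln l%:R :> R. Proof. by rewrite ln_ge0 // ler1n. Qed.

Lemma inv_sum_sub_mean :
  inv_sum - mean = block_sum (geometric (1 - s ^+ 2) (s ^+ 2))
    (fun h => h%:R^-1 - irr_density h) m l.
Proof. by rewrite (mean_truncL_block_sum _ size_b) // s_sqr block_sumBr. Qed.

Let irr_density_defect0 : 0%:R^-1 - irr_density 0 = 0.
Proof. by rewrite /irr_density nb_monic_irr0 mul0r invr0 subrr. Qed.
Let irr_density_defect1 : 1%:R^-1 - irr_density 1 = 0.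
Proof. by rewrite irr_density1 invr1 subrr. Qed.

Lemma mean_truncL_approx_linear : `|mean - inv_sum| <= 8 * x.
Proof.
rewrite distrC inv_sum_sub_mean ger0_norm.
  apply: le_trans (geometric_error_sum_le_sqr s_bounds inv_sub_irr_density_bounds
    irr_density_defect0 irr_density_defect1 m l) _.
  rewrite s_sqr mulrAC ler_wpM2r ?(ltW x_gt0) // ler_pdivrMr; have := s_le; lra.
exact: geometric_error_sum_ge0 s_bounds inv_sub_irr_density_bounds m l.
Qed.

Lemma mean_truncL_approx_exp : `|mean - inv_sum| <= 32 * s ^+ m.-1.
Proof.
rewrite distrC inv_sum_sub_mean ger0_norm.
  apply: le_trans
    (geometric_error_sum_le_exp s_bounds inv_sub_irr_density_bounds l m_gt0) _.
  rewrite mulrAC ler_wpM2r ?exprn_ge0 ?(ltW s_gt0) //.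
  have /andP[_ s_lt1] := s_bounds; have := s_le.
  by rewrite ler_pdivrMr ?exprn_gt0 ?subr_gt0 //; nra.
exact: geometric_error_sum_ge0 s_bounds inv_sub_irr_density_bounds m l.
Qed.

Lemma mean_truncL_large_q :
  `|mean - \sum_(1 <= h < m * l | (h%:Z == -1 %[mod m%:Z])%Z) h%:R^-1|
  <= 58 * (ln l%:R / (m%:R * Q) + x).
Proof.
rewrite sum_inv_residue //; apply: le_trans (ler_distD inv_sum _ _) _.
apply: le_trans (lerD mean_truncL_approx_linear
  (geometric_inv_sum_leading x_bounds l m_gt0)) _.
have /andP[_ H_le] := harmonic_sub_ln_bounds R l_gt0.
apply: (@le_trans _ _ (8 * x + 50 * x / m%:R * (1 + ln l%:R))).
  by rewrite lerD2l ler_wpM2l ?divr_ge0 ?mulr_ge0 ?(ltW x_gt0) //; lra.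
rewrite invfM; have := ler_piMr (ltW x_gt0) m_inv_le1.
have : 0 <= ln l%:R * (m%:R^-1 * x) by rewrite !mulr_ge0 ?invr_ge0 ?(ltW x_gt0).
have -> : 50 * x / m%:R * (1 + ln l%:R) = 50 * (x / m%:R) + 50 * (ln l%:R * (m%:R^-1 * x)).
  by ring.
lra.
Qed.

Lemma sqrt_exp_error_le : s ^+ m.-1 * (1 + ln (m * l)%:R)
  <= 6 * ((m%:R ^+ 3)^-1 + Q * ln (m%:R * l%:R) ^+ 2 / (Q `^ (m%:R / 2))).
Proof.
have Q_powR : (Q `^ (m%:R / 2))^-1 = s ^+ m.
  rewrite mulrC powRrM powR12_sqrt ?ltW // powR_mulrn ?sqrtr_ge0 //.
  by rewrite sqrtrV ?ltW // exprVn.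
have s_unit : 0 < s <= 1 by rewrite s_gt0; have /andP[_ /ltW] := s_bounds.
have := exponential_error_le s_unit m_gt0 l_gt0.
by rewrite s_sqr invrK Q_powR natrM.
Qed.

Lemma sqrt_correction_le :
  `|x ^+ m / m%:R * H 1 l + x ^+ m * (m%:R + (1 - x)^-1) / m%:R ^+ 2 * H 2 l|
  <= 7 * (s ^+ m.-1 * (1 + ln (m * l)%:R)).
Proof.
have /andP[s_ge0 /ltW s_le1] := s_bounds.
apply: le_trans (geometric_correction_le x_bounds m_gt0 l_gt0) _.
rewrite ler_wpM2l // ler_pM ?addr_ge0 ?exprn_ge0 ?(ltW x_gt0) //.
  rewrite -[X in X ^+ m <= _]s_sqr -exprM ler_wiXn2l //.
  by rewrite (leq_trans (leq_pred m)) ?leq_pmull.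
by rewrite lerD2l ler_ln ?posrE ?ltr0n ?muln_gt0 ?m_gt0 // ler_nat leq_pmull.
Qed.

Lemma mean_truncL_large_m :
  `|mean - (m%:R^-1 * \sum_(1 <= h < l.+1) h%:R^-1
      + Q / ((Q - 1) * m%:R ^+ 2) * \sum_(1 <= h < l.+1) (h%:R ^+ 2)^-1)|
  <= 330 * ((m%:R ^+ 3)^-1 + Q * ln (m%:R * l%:R) ^+ 2 / (Q `^ (m%:R / 2))).
Proof.
rewrite (gen_harmonic_nat R 1) gen_harmonic_nat.
have exp_error := sqrt_exp_error_le.
have approx_le : `|mean - inv_sum| <= 32 * (s ^+ m.-1 * (1 + ln (m * l)%:R)).
  apply: le_trans mean_truncL_approx_exp _.
  rewrite ler_wpM2l // ler_peMr ?exprn_ge0 ?sqrtr_ge0 // lerDl ln_ge0 //.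
  by rewrite ler1n muln_gt0 m_gt0.
have Q1 : Q - 1 != 0 by rewrite subr_eq0 pnatr_eq1 gtn_eqF ?finNzRing_gt1.
have x_compl : (1 - x)^-1 = Q / (Q - 1).
  by field; rewrite Q1 gt_eqF.
have -> : mean - (m%:R^-1 * H 1 l + Q / ((Q - 1) * m%:R ^+ 2) * H 2 l) = (mean - inv_sum)
    + (inv_sum - ((1 - x ^+ m) / m%:R * H 1 l
        + ((1 - x)^-1 - x ^+ m * (m%:R + (1 - x)^-1)) / m%:R ^+ 2 * H 2 l))
    - (x ^+ m / m%:R * H 1 l + x ^+ m * (m%:R + (1 - x)^-1) / m%:R ^+ 2 * H 2 l).
  rewrite x_compl; move: (x ^+ m) => c.
  by field; rewrite Q1 gt_eqF.
apply: le_trans (ler_normB _ _) _.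
apply: le_trans (lerD (ler_normD _ _) sqrt_correction_le) _.
apply: le_trans (lerD (lerD approx_le (geometric_inv_sum_order2 x_bounds m l)) (lexx _)) _.
set E := Q * _ / _ in exp_error *.
have E_ge0 : 0 <= E by rewrite divr_ge0 ?powR_ge0 // mulr_ge0 ?sqr_ge0 ?ler0n.
by move: (_ * _) (m%:R ^+ 3)^-1 exp_error => a c; lra.
Qed.

Lemma mean_truncL_large_l :
  `|mean - m%:R^-1 * (1 - (Q ^+ m)^-1) * ln l%:R| <= 105 * (m%:R^-1 + x).
Proof.
have -> : mean - m%:R^-1 * (1 - (Q ^+ m)^-1) * ln l%:R = (mean - inv_sum)
    + (inv_sum - (1 - x ^+ m) / m%:R * H 1 l) + (1 - x ^+ m) / m%:R * (H 1 l - ln l%:R).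
  by rewrite -exprVn; ring.
have xm_le1 : x ^+ m <= 1.
  by rewrite exprn_ile1 ?(ltW x_gt0) //; have /andP[] := x_bounds; lra.
have log_error_le : `|(1 - x ^+ m) / m%:R * (H 1 l - ln l%:R)| <= m%:R^-1.
  have /andP[H_ge H_le] := harmonic_sub_ln_bounds R l_gt0.
  have c_ge0 : 0 <= 1 - x ^+ m by rewrite subr_ge0.
  have c_le1 : 1 - x ^+ m <= 1 by rewrite gerBl exprn_ge0 ?(ltW x_gt0).
  by rewrite ger0_norm ?mulr_ge0 ?invr_ge0 // mulrAC ler_piMl ?invr_ge0 ?mulr_ile1.
apply: le_trans (ler_normD _ _) _; apply: le_trans (lerD (ler_normD _ _) log_error_le) _.
apply: le_trans (lerD (lerD mean_truncL_approx_linear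
  (geometric_inv_sum_order1 x_bounds m l)) (lexx _)) _.
have : (m%:R ^+ 2)^-1 <= m%:R^-1 :> R.
  by rewrite -exprVn expr2 ler_piMl ?invr_ge0.
have := x_gt0; have : 0 < m%:R^-1 :> R by rewrite invr_gt0.
move: (m%:R ^+ 2)^-1 m%:R^-1 x => a c z; lra.
Qed.
End Estimates.
End MeanTruncations.

Theorem theorem1p2 (R : realType) :
  (exists C : R, 0 < C /\
    forall (q : nat) (F : finFieldType) (b : {poly F}) (m l : nat),
      #|F| = q -> size b = m.+1 -> (1 <= m)%N -> (1 <= l)%N ->
      `| mean_truncL R b l
         - \sum_(1 <= h < m * l | (h%:Z == -1 %[mod m%:Z])%Z) h%:R^-1 |
      <= C * (ln l%:R / (m%:R * q%:R) + q%:R^-1))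
  /\
  (exists C : R, 0 < C /\
    forall (q : nat) (F : finFieldType) (b : {poly F}) (m l : nat),
      #|F| = q -> size b = m.+1 -> (1 <= m)%N -> (1 <= l)%N ->
      `| mean_truncL R b l
         - (m%:R^-1 * \sum_(1 <= h < l.+1) h%:R^-1
            + q%:R / ((q%:R - 1) * m%:R ^+ 2)
              * \sum_(1 <= h < l.+1) (h%:R ^+ 2)^-1) |
      <= C * ((m%:R ^+ 3)^-1
              + q%:R * ln (m%:R * l%:R) ^+ 2 / (q%:R `^ (m%:R / 2))))
  /\
  (exists C : R, 0 < C /\
    forall (q : nat) (F : finFieldType) (b : {poly F}) (m l : nat),
      #|F| = q -> size b = m.+1 -> (1 <= m)%N -> (1 <= l)%N ->
      `| mean_truncL R b l
         - m%:R^-1 * (1 - (q%:R ^+ m)^-1) * ln l%:R |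
      <= C * (m%:R^-1 + q%:R^-1)).
Proof.
split; [|split].
- by exists 58; split=> // _ F b m l <-; exact: mean_truncL_large_q.
- by exists 330; split=> // _ F b m l <-; exact: mean_truncL_large_m.
- by exists 105; split=> // _ F b m l <-; exact: mean_truncL_large_l.
Qed.
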